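(* Let $H$ be an $\ell$-graph with at least one edge. The number of $H$-free $\ell$-graphs on vertex set $[N]$ is $$2^{(\pi(H)+o(1))\binom{N}{\ell}}$$ as $N\to\infty$.
   Context: An $\ell$-graph is an $\ell$-uniform hypergraph and $[N]=\{1,\ldots,N\}$. An $\ell$-graph is $H$-free if it contains no subgraph isomorphic to $H$. $\mathrm{ex}(N,H)$ is the maximum number of edges in an $H$-free $\ell$-graph on $N$ vertices, and $\pi(H)=\lim_{N\to\infty}\mathrm{ex}(N,H)\binom{N}{\ell}^{-1}$. The graphs counted are labelled, i.e. distinct edge sets on $[N]$. *)

(* Defs.v *)
From HB Require Import structures.
From mathcomp Require Import all_boot all_order all_algebra.
From mathcomp Require Import reals topology normedtype sequences exp.
Set Implicit Arguments.
Unset Strict Implicit.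
Unset Printing Implicit Defensive.
Import Order.TTheory GRing.Theory Num.Theory.
Import numFieldNormedType.Exports.

(* A hypergraph on the vertex set V is identified with its set of edges, of
   type {set {set V}}, so labelled hypergraphs on V are distinct edge sets. *)

Definition uniform (l : nat) (V : finType) (G : {set {set V}}) : bool :=
  [forall e in G, #|e| == l].

(* The copy of H under an injective f : V -> U has vertex set f @: V and edges
   f @: e; it need not be induced, and isolated vertices of H are also
   embedded. *)
Definition contains (V U : finType) (H : {set {set V}}) (G : {set {set U}})
    : bool :=
  [exists f : {ffun V -> U},
     injectiveb f && [forall e in H, f @: (e : {set V}) \in G]].

(* 'I_N = {0, ..., N-1} plays the role of {1, ..., N}. *)
Definition free_graph (l : nat) (V : finType) (H : {set {set V}}) (N : nat)
    (G : {set {set 'I_N}}) : bool :=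
  uniform l G && ~~ contains H G.

Definition nb_free (l : nat) (V : finType) (H : {set {set V}}) (N : nat) : nat :=
  #|[pred G : {set {set 'I_N}} | free_graph l H G]|.

Definition turan_number (l : nat) (V : finType) (H : {set {set V}}) (N : nat) : nat :=
  \max_(G : {set {set 'I_N}} | free_graph l H G) #|G|.

Definition turan_density (R : realType) (l : nat) (V : finType)
    (H : {set {set V}}) : R :=
  limn (fun N : nat => (turan_number l H N)%:R / 'C(N, l)%:R : R)%R.

(* Main.v *)
Require Import Defs.
From HB Require Import structures.
From mathcomp Require Import all_boot all_order all_algebra.
From mathcomp Require Import perm ring lra zify.
From mathcomp Require Import reals topology normedtype sequences exp.
Import Order.TTheory GRing.Theory Num.Theory.
Import numFieldNormedType.Exports.
Set Implicit Arguments.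
Unset Strict Implicit.
Unset Printing Implicit Defensive.
Local Open Scope classical_set_scope.
Local Open Scope ring_scope.

(** Write [F] for the set of [H]-free graphs on [N] vertices, let [G] be uniform
in [F], and measure entropies in nats.

The lower bound is immediate: every subgraph of an extremal graph is [H]-free, so
[2 ^ ex(N, H) <= #|F|].

For the upper bound, fix a set [A] of boundedly many vertices and reveal the
edges of [G] that meet [A].  These are a vanishing proportion of all the
[l]-sets, so they carry little entropy.  As [F] is invariant under permutations
of the vertices, the conditional entropy of the indicator of an edge [e] disjoint
from [A], given the revealed edges, depends only on the size of [A]; call it
[gain A e].  It lies in the interval from 0 to 1 and decreases when [A] grows, so
if [A] is enlarged [T] times by [M] vertices, then some step loses at most [1 / T]
([exists_small_drop]).

Let that step pass from [A] to [A :|: B].  Every edge of [B] other than [e]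
meets [B :\: e], so revealing the edges that meet [A :|: (B :\: e)] reveals all of
them: conditionally on the edges meeting [A], the [K = 'C(M, l)] edge indicators
inside [B] have total correlation at most [K / T], that is, they are almost
independent.  Now let [C] be the set of edges of [B] whose conditional
probability is at least [s ^ 2].  Were they independent, [C] would be the graph
induced on [B] with probability at least [s ^ (2 * K)]; as the actual graph on
[B] is [H]-free, [C] has to be [H]-free too, up to an error controlled by the
total correlation ([total_correlation_ge]).  So [C] has at most [ex(M, H)] edges,
each of entropy at most [ln 2], while the edges outside [C] have entropy at most
[3 * s] ([sum_ent1_le]).  Averaging, [gain A e] is at most
[(ex(M, H) / 'C(M, l)) * ln 2] plus a small error ([gain_bound]), and revealing
the edges disjoint from [A] one by one yields
[ln #|F| <= (ex(M, H) / 'C(M, l) * ln 2 + small) * 'C(N, l)]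
for every fixed [M] and all large [N] ([log_ratio_upper]).

With [u N = ex(N, H) / 'C(N, l)] and [v N = log2 #|F| / 'C(N, l)] this says that
[u N <= v N], and that [v N <= u M + eps] for every [M >= l] and all large [N].
Both sequences therefore converge to the infimum of [u M] over [M >= l]
([common_limit]), which is the Turan density. *)

(** * Entropy of the traces of a set family *)

Section Entropy.
Variables (R : realType) (E : finType).
Implicit Types (F : {set {set E}}) (S T Q A G : {set E}).

Definition mean F (f : {set E} -> R) : R := (\sum_(G in F) f G) / #|F|%:R.

Definition fiber F S A : {set {set E}} := [set G in F | G :&: S == A :&: S].

Definition trace F S : {set {set E}} := [set G :&: S | G in F].

(** The Shannon entropy of [G :&: S] for [G] uniform in [F].  Averaging over [F],
    rather than summing over the traces, keeps every logarithm at a positive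
    argument. *)
Definition ent F S : R :=
  mean F (fun G => ln (#|F|%:R / #|fiber F S G|%:R)).

Lemma ln_le_subr1 (x : R) : 0 < x -> ln x <= x - 1.
Proof.
by move=> x0; have := @le_ln1Dx R (x - 1); rewrite (addrC 1) subrK; apply; lra.
Qed.

Lemma ln2_gt0 : 0 < ln 2 :> R.
Proof. by rewrite ln_gt0// ltr1n. Qed.

Lemma ln2_le1 : ln 2 <= 1 :> R.
Proof. by have := @ln_le_subr1 2; rewrite ltr0n => /(_ isT); lra. Qed.

Lemma ln2_ge_half : 2^-1 <= ln 2 :> R.
Proof.
have := @ln_le_subr1 2^-1; rewrite invr_gt0 ltr0n => /(_ isT).
by rewrite lnV ?posrE ?ltr0n//; lra.
Qed.

Lemma eq_mean F f g : {in F, f =1 g} -> mean F f = mean F g.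
Proof. by move=> fg; congr (_ / _); apply: eq_bigr. Qed.

Lemma le_mean F f g : {in F, forall G, f G <= g G} -> mean F f <= mean F g.
Proof. by move=> fg; rewrite ler_wpM2r ?invr_ge0 ?ler0n ?ler_sum. Qed.

Lemma meanD F f g : mean F (fun G => f G + g G) = mean F f + mean F g.
Proof. by rewrite /mean big_split mulrDl. Qed.

Lemma meanZ F (c : R) f : mean F (fun G => c * f G) = c * mean F f.
Proof. by rewrite /mean -mulr_sumr mulrA. Qed.

Lemma meanN F f : mean F (fun G => - f G) = - mean F f.
Proof. by rewrite /mean sumrN mulNr. Qed.

Lemma mean_sum (I : finType) (P : pred I) F (f : I -> {set E} -> R) :
  mean F (fun G => \sum_(i | P i) f i G) = \sum_(i | P i) mean F (f i).
Proof. by rewrite /mean exchange_big mulr_suml. Qed.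

Lemma mean_cst F c : F != set0 -> mean F (fun=> c) = c.
Proof.
move=> F0; rewrite /mean sumr_const -[c *+ _]mulr_natr mulfK//.
by rewrite pnatr_eq0 cards_eq0.
Qed.

Lemma fiber_sub F S A : fiber F S A \subset F.
Proof. by apply/subsetP => G; rewrite inE => /andP[]. Qed.

Lemma fiber_self F S G : G \in F -> G \in fiber F S G.
Proof. by move=> GF; rewrite inE GF eqxx. Qed.

Lemma fiber_neq0 F S G : G \in F -> fiber F S G != set0.
Proof. by move=> GF; apply/set0Pn; exists G; exact: fiber_self. Qed.

Lemma fiber_gt0 F S G : G \in F -> 0 < #|fiber F S G|%:R :> R.
Proof. by move=> GF; rewrite ltr0n card_gt0 fiber_neq0. Qed.

Lemma fiber_eq F S G G' : G' \in fiber F S G -> fiber F S G' = fiber F S G.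
Proof. by rewrite inE => /andP[_ /eqP e]; apply/setP => A; rewrite !inE e. Qed.

Lemma fiber_trace F S A : fiber F S (A :&: S) = fiber F S A.
Proof. by apply/setP => G; rewrite !inE -setIA setIid. Qed.

Lemma setIU_eq A G S T :
  (A :&: (S :|: T) == G :&: (S :|: T)) =
  (A :&: S == G :&: S) && (A :&: T == G :&: T).
Proof.
apply/eqP/andP => [e|[/eqP eS /eqP eT]]; last by rewrite !setIUr eS eT.
have hS X : X :&: S = X :&: (S :|: T) :&: S by rewrite -setIA setUK.
have hT X : X :&: T = X :&: (S :|: T) :&: T by rewrite -setIA (setUC S) setUK.
by rewrite (hS A) (hT A) e -hS -hT.
Qed.

Lemma fiberU F S T G :
  fiber F (S :|: T) G = fiber (fiber F S G) T G.
Proof. by apply/setP => A; rewrite !inE setIU_eq andbA. Qed.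

(** Law of total expectation: fibers partition [F]. *)
Lemma mean_fiber F S f : mean F (fun G => mean (fiber F S G) f) = mean F f.
Proof.
rewrite /mean; congr (_ / _).
under eq_bigr => G _ do rewrite mulr_suml.
rewrite (exchange_big_dep (fun G => G \in F)) /=; last first.
  by move=> G G' _ /(subsetP (fiber_sub _ _ _)).
apply: eq_bigr => G' G'F.
rewrite (eq_bigl (fun G => G \in fiber F S G')); last first.
  by move=> G; rewrite !inE G'F /= eq_sym.
rewrite (eq_bigr (fun=> f G' / #|fiber F S G'|%:R)); last first.
  by move=> G /fiber_eq ->.
by rewrite sumr_const -[_ *+ #|_|]mulr_natr mulfVK// gt_eqF ?fiber_gt0.
Qed.

(** Chain rule: [ent F (S :|: T) - ent F S] is a conditional entropy. *)
Lemma entU F S T :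
  ent F (S :|: T) = ent F S + mean F (fun G => ent (fiber F S G) T).
Proof.
pose psi G := ln (#|fiber F S G|%:R / #|fiber F (S :|: T) G|%:R) : R.
have -> : mean F (fun G => ent (fiber F S G) T) = mean F psi.
  rewrite -(mean_fiber F S psi); apply: eq_mean => G GF; apply: eq_mean => G' G'G.
  by rewrite /psi fiberU (fiber_eq G'G).
rewrite /ent -meanD; apply: eq_mean => G GF; rewrite /psi.
have F0 : 0 < #|F|%:R :> R by rewrite ltr0n card_gt0; apply/set0Pn; exists G.
have S0 := fiber_gt0 S GF; have ST0 := fiber_gt0 (S :|: T) GF.
rewrite -lnM ?posrE ?divr_gt0//; congr ln; field.
by rewrite !gt_eqF.
Qed.

(** A fiber of [k] elements contributes [k] times [1 / k]: weighting by the inverse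
    size of the fiber turns a sum over [F] into a sum over traces. *)
Lemma sum_fiberV F S (q : {set E} -> R) :
  \sum_(G in F) q (G :&: S) / #|fiber F S G|%:R = \sum_(A in trace F S) q A.
Proof.
rewrite (partition_big_imset (fun G => G :&: S)) /=; apply: eq_bigr => A.
case/imsetP => G GF ->.
rewrite (eq_bigl (fun G' => G' \in fiber F S G)); last by move=> G'; rewrite inE.
rewrite (eq_bigr (fun=> q (G :&: S) / #|fiber F S G|%:R)); last first.
  by move=> G' G'G; rewrite (fiber_eq G'G); move: G'G; rewrite inE => /andP[_ /eqP->].
by rewrite sumr_const -[_ *+ #|_|]mulr_natr mulfVK// gt_eqF ?fiber_gt0.
Qed.

(** Gibbs' inequality, from [ln x <= x - 1]: coding the traces on [S] with
    weights [q] costs at least the entropy, up to the excess of the total weight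
    of the traces over [1].  The weight that [q] spends outside [trace F S] is
    therefore a lower bound for the loss. *)
Lemma gibbs F S (q : {set E} -> R) : F != set0 ->
  {in F, forall G, 0 < q (G :&: S)} ->
  ent F S <= mean F (fun G => - ln (q (G :&: S)))
             + (\sum_(A in trace F S) q A - 1).
Proof.
move=> Fn0 q0.
have F0 : 0 < #|F|%:R :> R by rewrite ltr0n card_gt0.
rewrite -lerBlDl -(mean_cst 1 Fn0) -sum_fiberV.
have -> : \sum_(G in F) q (G :&: S) / #|fiber F S G|%:R =
          mean F (fun G => q (G :&: S) * (#|F|%:R / #|fiber F S G|%:R)).
  rewrite /mean mulr_suml; apply: eq_bigr => G GF.
  by field; rewrite !gt_eqF ?fiber_gt0.
rewrite -!meanN -!meanD; apply: le_mean => G GF.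
have := fiber_gt0 S GF; have := q0 _ GF => qp cp.
by rewrite opprK addrC -lnM ?posrE ?divr_gt0// ln_le_subr1// mulr_gt0 ?divr_gt0.
Qed.

Lemma ent_ge0 F S : 0 <= ent F S.
Proof.
rewrite divr_ge0 ?ler0n// sumr_ge0// => G GF; rewrite ln_ge0//.
by rewrite ler_pdivlMr ?fiber_gt0// mul1r ler_nat subset_leq_card// fiber_sub.
Qed.

Lemma trace_sub_powerset F S : trace F S \subset powerset S.
Proof. by apply/subsetP => A /imsetP[G _ ->]; rewrite inE subsetIr. Qed.

(** Gibbs with the uniform weights on the subsets of [S]. *)
Lemma ent_le F S : F != set0 -> ent F S <= #|S|%:R * ln 2.
Proof.
move=> Fn0; have p0 : 0 < (2 ^+ #|S|)^-1 :> R by rewrite invr_gt0 exprn_gt0.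
have := @gibbs F S (fun=> (2 ^+ #|S|)^-1) Fn0 (fun _ _ => p0).
rewrite mean_cst// lnV ?posrE ?exprn_gt0// opprK lnXn//.
rewrite -[ln 2 *+ _]mulr_natl => /le_trans; apply.
rewrite gerDl subr_le0 sumr_const -[_ *+ #|_|]mulr_natr.
rewrite ler_pdivrMl ?exprn_gt0// mulr1 -natrX -card_powerset ler_nat.
exact/subset_leq_card/trace_sub_powerset.
Qed.

Lemma sum_freq F S : F != set0 ->
  \sum_(A in trace F S) #|fiber F S A|%:R / #|F|%:R = 1 :> R.
Proof.
move=> Fn0; have F0 : 0 < #|F|%:R :> R by rewrite ltr0n card_gt0.
rewrite -(sum_fiberV F S (fun A => #|fiber F S A|%:R / #|F|%:R)).
rewrite (eq_bigr (fun=> #|F|%:R^-1)); last first.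
  move=> G GF; rewrite fiber_trace mulrC mulrA mulVf ?mul1r// gt_eqF//.
  exact: fiber_gt0.
by rewrite sumr_const -[_ *+ #|_|]mulr_natr mulVf// gt_eqF.
Qed.

(** Gibbs with the product of the two marginal distributions as weights: the traces
    on [S :|: T] embed into pairs of traces, over which these weights sum to 1. *)
Lemma ent_subadd F S T : F != set0 -> ent F (S :|: T) <= ent F S + ent F T.
Proof.
move=> Fn0; have F0 : 0 < #|F|%:R :> R by rewrite ltr0n card_gt0.
pose p U A : R := #|fiber F U A|%:R / #|F|%:R.
have p0 U G : G \in F -> 0 < p U G by move=> GF; rewrite divr_gt0 ?fiber_gt0.
have pI (U G : {set E}) : U \subset S :|: T -> p U (G :&: (S :|: T)) = p U G.
  by move=> sU; rewrite /p -fiber_trace -setIA (setIidPr sU) fiber_trace.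
have sS := subsetUl S T; have sT := subsetUr S T.
have entE U : ent F U = mean F (fun G => - ln (p U G)).
  by apply: eq_mean => G GF; rewrite -lnV ?posrE ?p0// invf_div.
have q0 : {in F, forall G, 0 < p S (G :&: (S :|: T)) * p T (G :&: (S :|: T))}.
  by move=> G GF; rewrite !pI// mulr_gt0 ?p0.
have := @gibbs F (S :|: T) (fun A => p S A * p T A) Fn0 q0.
rewrite !entE -meanD => /le_trans; apply.
rewrite (_ : mean F _ = mean F (fun G => - ln (p S G) - ln (p T G))); last first.
  by apply: eq_mean => G GF; rewrite !pI// lnM ?posrE ?p0// opprD.
rewrite gerDl subr_le0.
pose h (A : {set E}) := (A :&: S, A :&: T).
have hinj : {in trace F (S :|: T) &, injective h}.
  move=> _ _ /imsetP[A _ ->] /imsetP[B _ ->] [].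
  rewrite -!setIA (setIidPr sS) (setIidPr sT) => eS eT.
  by apply/eqP; rewrite setIU_eq eS eT !eqxx.
pose w (X : {set E} * {set E}) := p S X.1 * p T X.2.
rewrite (eq_bigr (fun A => w (h A))); last first.
  by move=> A _; rewrite /w /p !fiber_trace.
rewrite -(big_imset w hinj) /=.
apply: (@le_trans _ _ (\sum_(X in setX (trace F S) (trace F T)) w X)).
  rewrite [leRHS](big_setID (h @: trace F (S :|: T))) /= (setIidPr _).
    by rewrite lerDl sumr_ge0// => X _; rewrite mulr_ge0 ?divr_ge0 ?ler0n.
  apply/subsetP => _ /imsetP[_ /imsetP[G GF ->] ->]; rewrite inE /h /=.
  rewrite -!setIA (setIidPr sS) (setIidPr sT).
  by apply/andP; split; apply/imsetP; exists G.
rewrite (eq_bigl (fun X => (X.1 \in trace F S) && (X.2 \in trace F T))); last first.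
  by move=> X; rewrite inE.
rewrite -(pair_big (fun A => A \in trace F S) (fun A => A \in trace F T)
  (fun A B => p S A * p T B)) /=.
by rewrite -big_distrlr /= !sum_freq// mulr1.
Qed.

(** Conditioning on more reduces entropy: this is subadditivity inside each fiber
    of [F] over [S]. *)
Lemma ent_submod F S T Q : F != set0 ->
  ent F (S :|: T :|: Q) - ent F (S :|: T) <= ent F (S :|: Q) - ent F S.
Proof.
move=> Fn0; rewrite -setUA !entU.
suff : mean F (fun G => ent (fiber F S G) (T :|: Q)) <=
  mean F (fun G => ent (fiber F S G) T) + mean F (fun G => ent (fiber F S G) Q).
  by lra.
by rewrite -meanD; apply: le_mean => G GF; rewrite ent_subadd ?fiber_neq0.
Qed.

Lemma ent_mono F S T : S \subset T -> ent F S <= ent F T.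
Proof.
move=> /setUidPr <-; rewrite entU lerDl divr_ge0 ?ler0n//.
by apply: sumr_ge0 => G _; exact: ent_ge0.
Qed.

(** * Families whose coordinates are almost independent *)

Definition freq F (e : E) : R := #|[set G in F | e \in G]|%:R / #|F|%:R.

(** The distribution on the subsets of [Q] under which the elements of [Q] occur
    independently, each with its frequency in [F]. *)
Definition prodw F Q A : R :=
  \prod_(e in Q) (if e \in A then freq F e else 1 - freq F e).

Lemma freq_ge0 F e : 0 <= freq F e.
Proof. by rewrite divr_ge0 ?ler0n. Qed.

Lemma freq_le1 F e : F != set0 -> freq F e <= 1.
Proof.
move=> Fn0; rewrite ler_pdivrMr ?ltr0n ?card_gt0// mul1r ler_nat.
by rewrite subset_leq_card//; apply/subsetP => G; rewrite inE => /andP[].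
Qed.

Lemma freqC F e : F != set0 ->
  1 - freq F e = #|[set G in F | e \notin G]|%:R / #|F|%:R.
Proof.
move=> Fn0; have F0 : #|F|%:R != 0 :> R by rewrite pnatr_eq0 cards_eq0.
apply/eqP; rewrite subr_eq -mulrDl -natrD addnC.
suff -> : (#|[set G in F | e \in G]| + #|[set G in F | e \notin G]|)%N = #|F|.
  by rewrite divff.
rewrite -(cardsID [set G : {set E} | e \in G] F); congr (_ + _)%N; apply: eq_card => G;
  by rewrite !inE andbC.
Qed.

Lemma fiber1 F e A : F != set0 ->
  #|fiber F [set e] A|%:R / #|F|%:R =
  (if e \in A then freq F e else 1 - freq F e) :> R.
Proof.
move=> Fn0; have fE : fiber F [set e] A =
    [set G in F | (e \in G) == (e \in A)].
  apply/setP => G; rewrite !inE; congr (_ && _).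
  apply/eqP/eqP => [eGA|eGA].
    by have := congr1 (fun X : {set E} => e \in X) eGA; rewrite !inE eqxx !andbT.
  by apply/setP => f; rewrite !inE; case: eqVneq => [->|]; rewrite ?andbF ?andbT.
rewrite fE; case: ifP => eA.
  by congr (_%:R / _); apply: eq_card => G; rewrite !inE eqb_id.
rewrite freqC//.
by congr (_%:R / _); apply: eq_card => G; rewrite !inE eqbF_neg.
Qed.

Lemma ent1_mean F e : F != set0 -> ent F [set e] =
  mean F (fun G => - ln (if e \in G then freq F e else 1 - freq F e)).
Proof.
move=> Fn0; have F0 : 0 < #|F|%:R :> R by rewrite ltr0n card_gt0.
apply: eq_mean => G GF; rewrite -fiber1// -lnV ?posrE ?invf_div//.
by rewrite divr_gt0// fiber_gt0.
Qed.

Lemma ent1 F e : F != set0 -> ent F [set e] =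
  freq F e * - ln (freq F e) + (1 - freq F e) * - ln (1 - freq F e).
Proof.
move=> Fn0; rewrite ent1_mean// /mean.
rewrite (bigID (fun G : {set E} => e \in G)) /= mulrDl; congr (_ + _).
  rewrite (eq_bigr (fun=> - ln (freq F e))); last by move=> G /andP[_ ->].
  rewrite sumr_const -[_ *+ #|_|]mulr_natr -mulrA mulrC.
  by congr (_ / _ * _); congr (_%:R); apply: eq_card => G; rewrite !inE.
rewrite (eq_bigr (fun=> - ln (1 - freq F e))); last first.
  by move=> G /andP[_ /negPf->].
rewrite sumr_const -[_ *+ #|_|]mulr_natr -mulrA mulrC freqC//.
by congr (_ / _ * _); congr (_%:R); apply: eq_card => G; rewrite !inE.
Qed.

(** From [- ln r <= 1 / r - 1] at [r = Num.sqrt p]. *)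
Lemma mulNln_le (p s : R) : 0 < s -> p <= s ^+ 2 -> p * - ln p <= 2 * s.
Proof.
move=> s0 ps; have [p0|p0] := leP p 0; first by rewrite ln0// oppr0; lra.
have r0 : 0 < Num.sqrt p by rewrite sqrtr_gt0.
have rs : Num.sqrt p <= s by rewrite -(ger0_norm (ltW s0)) -sqrtr_sqr ler_wsqrtr.
have pE : p = Num.sqrt p ^+ 2 by rewrite sqr_sqrtr// ltW.
have := @ln_le_subr1 (Num.sqrt p)^-1; rewrite invr_gt0 => /(_ r0).
move: (Num.sqrt p) r0 rs pE => r r0 rs ->.
rewrite lnV ?posrE// lnXn// => h.
have : r ^+ 2 * - ln r <= r ^+ 2 * (r^-1 - 1) by rewrite ler_wpM2l ?sqr_ge0.
have -> : r ^+ 2 * (r^-1 - 1) = r - r ^+ 2 by field; rewrite gt_eqF.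
have := sqr_ge0 r; nra.
Qed.

Lemma ent1_small F e s : F != set0 -> 0 < s -> s <= 1 -> freq F e <= s ^+ 2 ->
  ent F [set e] <= 3 * s.
Proof.
move=> Fn0 s0 s1 ps; rewrite ent1//.
have := mulNln_le s0 ps; have := freq_le1 e Fn0; have := freq_ge0 F e.
move: ps; set p := freq F e => ps p0 p1 h.
suff : (1 - p) * - ln (1 - p) <= s by lra.
have [p1'|p1'] := leP (1 - p) 0; first by rewrite ln0// oppr0; lra.
have := @ln_le_subr1 (1 - p)^-1; rewrite invr_gt0 => /(_ p1').
rewrite lnV ?posrE// => h'.
have : (1 - p) * - ln (1 - p) <= (1 - p) * ((1 - p)^-1 - 1).
  by rewrite ler_wpM2l// ltW.
have -> : (1 - p) * ((1 - p)^-1 - 1) = p by field; rewrite gt_eqF.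
have : s ^+ 2 <= s by rewrite expr2 ger_pMl.
by lra.
Qed.

Lemma sum_prodw F Q : \sum_(A in powerset Q) prodw F Q A = 1.
Proof.
pose a e : R := if e \in Q then freq F e else 0.
pose b e : R := if e \in Q then 1 - freq F e else 1.
have : \prod_e (a e + b e) = 1.
  by apply: big1 => e _; rewrite /a /b; case: ifP => _; lra.
rewrite bigA_distr => <-.
rewrite [RHS](bigID (fun J : {set E} => J \subset Q)) /= [X in _ + X]big1 => [|J].
  rewrite addr0; apply: eq_big => [J|J]; first by rewrite inE.
  rewrite inE => JQ; rewrite /prodw big_mkcond; apply: eq_bigr => e _.
  rewrite /a /b; have [//|eQ] := boolP (e \in Q).
  by rewrite ifN//; apply: contra eQ; apply: subsetP.
case/subsetPn => e eJ eQ.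
by rewrite (bigD1 e)//= eJ /a (negPf eQ) mul0r.
Qed.

Lemma prodw_ge0 F Q A : F != set0 -> 0 <= prodw F Q A.
Proof.
move=> Fn0; apply: prodr_ge0 => e _.
by case: ifP => _; rewrite ?subr_ge0 ?freq_ge0 ?freq_le1.
Qed.

Lemma prodw_self_gt0 F Q G : G \in F -> 0 < prodw F Q (G :&: Q).
Proof.
move=> GF; have Fn0 : F != set0 by apply/set0Pn; exists G.
apply: prodr_gt0 => e eQ; rewrite inE eQ andbT -fiber1//.
by rewrite divr_gt0 ?fiber_gt0// ltr0n card_gt0.
Qed.

(** The left-hand side is the weight that the product of the marginals spends on
    non-traces; by Gibbs' inequality it is lost in the entropy of [Q].  The right-hand
    side vanishes exactly for independent coordinates. *)
Lemma total_correlation_ge F Q (X : {set {set E}}) : F != set0 ->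
  X \subset powerset Q -> [disjoint X & trace F Q] ->
  \sum_(A in X) prodw F Q A <= \sum_(e in Q) ent F [set e] - ent F Q.
Proof.
move=> Fn0 XQ Xd.
have := @gibbs F Q (prodw F Q) Fn0 (@prodw_self_gt0 F Q).
have -> : mean F (fun G => - ln (prodw F Q (G :&: Q))) =
          \sum_(e in Q) ent F [set e].
  rewrite (eq_bigr (fun e => mean F (fun G => - ln
    (if e \in G then freq F e else 1 - freq F e)))); last first.
    by move=> e _; rewrite ent1_mean.
  rewrite -mean_sum; apply: eq_mean => G GF.
  rewrite sumrN; congr (- _).
  rewrite /prodw (eq_bigr (fun e => if e \in G then freq F e else 1 - freq F e));
    last by move=> e eQ; rewrite inE eQ andbT.
  rewrite -big_enum -[RHS]big_enum /=.
  have : {subset enum Q <= Q} by move=> e; rewrite mem_enum.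
  elim: (enum Q) => [|e r IH] sr; first by rewrite !big_nil ln1.
  have pos f : f \in e :: r -> 0 < (if f \in G then freq F f else 1 - freq F f).
    move=> fr; rewrite -fiber1// divr_gt0 ?fiber_gt0//.
    by rewrite ltr0n card_gt0.
  rewrite !big_cons lnM ?posrE; first 1 last.
  - by apply: pos; rewrite inE eqxx.
  - by rewrite big_seq prodr_gt0// => f fr; apply: pos; rewrite inE fr orbT.
  by rewrite IH// => f fr; apply: sr; rewrite inE fr orbT.
have : \sum_(A in X) prodw F Q A + \sum_(A in trace F Q) prodw F Q A <= 1.
  rewrite -bigU// -(sum_prodw F Q).
  rewrite [leRHS](big_setID (X :|: trace F Q)) /= (setIidPr _); last first.
    by rewrite subUset XQ trace_sub_powerset.
  rewrite (eq_bigl (fun A => A \in X :|: trace F Q)); last first.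
    by move=> A; rewrite !inE.
  by rewrite lerDl sumr_ge0// => A _; exact: prodw_ge0.
by lra.
Qed.

Lemma ent_le_sum F Q : F != set0 -> ent F Q <= \sum_(e in Q) ent F [set e].
Proof.
move=> Fn0; have := @total_correlation_ge F Q set0 Fn0 (sub0set _).
by rewrite big_set0 subr_ge0; apply; rewrite disjoints_subset sub0set.
Qed.

(** Let [C] be the set of coordinates of frequency at least [s ^ 2].  Either [C] has
    at most [m] elements, and the first two terms bound the contributions of [C] and
    of the rest; or [C] is not a trace, its weight of at least [s ^ (2 * #|Q|)] is a
    lower bound for the total correlation, and the last term is at least the
    trivial bound [#|Q|]. *)
Lemma sum_ent1_le F Q (m : nat) s : F != set0 -> 0 < s -> s <= 2^-1 ->
  {in F, forall G, (#|G :&: Q| <= m)%N} ->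
  \sum_(e in Q) ent F [set e] <= m%:R * ln 2 + 3 * s * #|Q|%:R +
    #|Q|%:R / s ^+ (2 * #|Q|) * (\sum_(e in Q) ent F [set e] - ent F Q).
Proof.
move=> Fn0 s0 s12 Fm; have s1 : s <= 1 by lra.
have ln2 := ln2_gt0; have ln2' := ln2_le1.
set D := _ - ent F Q.
have K0 : 0 <= #|Q|%:R :> R by rewrite ler0n.
have sQ : 0 < s ^+ (2 * #|Q|) by rewrite exprn_gt0.
have e_le e : ent F [set e] <= ln 2.
  by have := ent_le [set e] Fn0; rewrite cards1 mul1r.
pose C := [set e in Q | s ^+ 2 <= freq F e].
have CQ : C \subset Q by apply/subsetP => e; rewrite inE => /andP[].
have [Cm|mC] := leqP #|C| m.
  have D0 : 0 <= D by rewrite subr_ge0 ent_le_sum.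
  apply: (@le_trans _ _ (m%:R * ln 2 + 3 * s * #|Q|%:R)); last first.
    by rewrite lerDl mulr_ge0// divr_ge0// ltW.
  rewrite (big_setID C) /= (setIidPr CQ) lerD//.
    apply: (@le_trans _ _ (\sum_(e in C) ln 2)); first exact: ler_sum.
    by rewrite sumr_const -[_ *+ #|_|]mulr_natl ler_wpM2r ?ler_nat// ltW.
  apply: (@le_trans _ _ (\sum_(e in Q :\: C) 3 * s)).
    apply: ler_sum => e; rewrite !inE negb_and -ltNge => /andP[+ eQ].
    by rewrite eQ /= => /ltW; exact: ent1_small.
  rewrite sumr_const -[_ *+ #|_|]mulr_natr ler_wpM2l ?ler_nat//; first lra.
  by rewrite subset_leq_card// subsetDl.
have CD : s ^+ (2 * #|Q|) <= D.
  have Ctr : [disjoint [set C] & trace F Q].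
    rewrite disjoints1; apply: contraL mC => /imsetP[G GF ->].
    by rewrite -leqNgt Fm.
  have := total_correlation_ge Fn0 _ Ctr; rewrite sub1set inE CQ big_set1.
  move/(_ isT); apply: le_trans.
  rewrite exprM -prodr_const; apply: ler_prod => e eQ; rewrite sqr_ge0 /= inE eQ /=.
  (* Outside [C] the factor is [1 - freq F e], which is large as [s ^+ 2 <= 1 / 4]. *)
  have [//|/ltW fs] := leP (s ^+ 2) (freq F e).
  by rewrite expr2 in fs *; nra.
apply: (@le_trans _ _ #|Q|%:R).
  rewrite -sum1_card natr_sum; apply: ler_sum => e _.
  exact: le_trans (e_le e) ln2'.
apply: (@le_trans _ _ (#|Q|%:R / s ^+ (2 * #|Q|) * D)).
  by rewrite -mulrA ler_peMr// mulrC ler_pdivlMr// mul1r.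
by rewrite lerDr addr_ge0// mulr_ge0// ?mulr_ge0 ?ltW.
Qed.

(** * Conditional entropies added one coordinate at a time *)

Lemma ent_chain_ge F S Q (a : R) :
  (forall e Q', e \in Q -> Q' \subset Q :\ e ->
     a <= ent F (S :|: Q' :|: [set e]) - ent F (S :|: Q')) ->
  a *+ #|Q| <= ent F (S :|: Q) - ent F S.
Proof.
move: {2}#|Q| (erefl #|Q|) => n; elim: n Q => [|n IH] Q nQ ha.
  by rewrite nQ; move/eqP: nQ; rewrite cards_eq0 => /eqP ->; rewrite setU0 subrr.
have [e eQ] : exists e, e \in Q by apply/set0Pn; rewrite -card_gt0 nQ.
have nQ' : #|Q :\ e| = n by apply/eqP; rewrite -eqSS -nQ (cardsD1 e Q) eQ.
have := IH _ nQ'; rewrite nQ nQ' mulrS => /(_ _) IH'.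
have := ha e _ eQ (subxx _); rewrite -setUA (setUC _ [set e]) setD1K// => h.
suff : a *+ n <= ent F (S :|: Q :\ e) - ent F S by lra.
apply: IH' => f Q' fQ Q'Q; apply: ha; first by move: fQ; rewrite inE => /andP[].
by apply: subset_trans Q'Q _; rewrite setSD// subD1set.
Qed.

Lemma ent_imset F S (phi : E -> E) : injective phi ->
  {in F, forall G, phi @: G \in F} -> ent F (phi @: S) = ent F S.
Proof.
move=> pI pF; have pII : injective (fun G : {set E} => phi @: G).
  exact: imset_inj.
have FE : [set phi @: (G : {set E}) | G in F] = F.
  apply/eqP; rewrite eqEcard card_imset// leqnn andbT.
  by apply/subsetP => _ /imsetP[G GF ->]; exact: pF.
rewrite /ent /mean -{1}FE big_imset /=; last by move=> ? ? _ _; exact: pII.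
congr (_ / _); apply: eq_bigr => G GF; congr (ln (_ / _%:R)).
rewrite -(card_imset (mem (fiber F S G)) pII); apply: eq_card => A.
have pE (B : {set E}) : (phi @: B :&: phi @: S == phi @: G :&: phi @: S) =
            (B :&: S == G :&: S).
  rewrite -!imsetI; try by move=> ? ? _ _; exact: pI.
  exact: (inj_eq pII).
apply/idP/imsetP => [|[B + ->]]; rewrite inE.
  by rewrite -{1}FE => /andP[/imsetP[B BF ->]]; rewrite pE => e; exists B; rewrite// inE BF.
by move=> /andP[/pF BF ?]; rewrite inE BF pE.
Qed.

(** All fibers over a set that contains every member are singletons. *)
Lemma ent_total F S : {in F, forall G, G \subset S} -> F != set0 ->
  ent F S = ln #|F|%:R.
Proof.
move=> FS Fn0; rewrite -(mean_cst (ln #|F|%:R) Fn0); apply: eq_mean => G GF.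
suff -> : fiber F S G = [set G] by rewrite cards1 divr1.
apply/setP => A; rewrite !inE (setIidPl (FS _ GF)).
apply/andP/eqP => [[AF]|->]; last by rewrite GF (setIidPl (FS _ GF)).
by rewrite (setIidPl (FS _ AF)) => /eqP.
Qed.

End Entropy.

(** * Relabelling [H]-free graphs *)

Definition pullback (U W : finType) (g : U -> W) (G : {set {set W}}) :
  {set {set U}} := [set e : {set U} | g @: e \in G].

Lemma free_pullback l (V : finType) (H : {set {set V}}) M N (g : 'I_M -> 'I_N)
    (G : {set {set 'I_N}}) :
  injective g -> free_graph l H G -> free_graph l H (pullback g G).
Proof.
move=> gI /andP[/forallP Gu Gc]; apply/andP; split.
  apply/forallP => e; apply/implyP; rewrite inE => eG.
  by have := Gu (g @: e); rewrite eG card_imset.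
apply: contra Gc => /existsP[f /andP[/injectiveP fI /forallP fH]].
apply/existsP; exists [ffun x => g (f x)]; apply/andP; split.
  by apply/injectiveP => x y; rewrite !ffunE => /gI/fI.
apply/forallP => e; apply/implyP => eH.
have := fH e; rewrite eH inE; congr (_ \in G).
by rewrite -imset_comp; apply: eq_imset => x; rewrite /= ffunE.
Qed.

Lemma free_sub l (V : finType) (H : {set {set V}}) N (G G' : {set {set 'I_N}}) :
  G' \subset G -> free_graph l H G -> free_graph l H G'.
Proof.
move=> /subsetP G'G /andP[/forallP Gu Gc]; apply/andP; split.
  apply/forallP => e; apply/implyP => /G'G eG.
  by have := Gu e; rewrite eG.
apply: contra Gc => /existsP[f /andP[fI /forallP fH]].
apply/existsP; exists f; rewrite fI; apply/forallP => e; apply/implyP => eH.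
by apply: G'G; have := fH e; rewrite eH.
Qed.

Lemma free_set0 l (V : finType) (H : {set {set V}}) N :
  (0 < #|H|)%N -> free_graph l H (set0 : {set {set 'I_N}}).
Proof.
rewrite card_gt0 => /set0Pn[e eH]; apply/andP; split.
  by apply/forallP => e'; rewrite inE.
by apply/negP => /existsP[f /andP[_ /forallP/(_ e)]]; rewrite eH inE.
Qed.

(** Colour each vertex by its membership in the two sets: both colourings use every
    colour equally often, so a permutation carries one to the other. *)
Lemma perm_disjoint_pairs N (A e A' e' : {set 'I_N}) :
  [disjoint e & A] -> [disjoint e' & A'] -> #|A| = #|A'| -> #|e| = #|e'| ->
  exists s : {perm 'I_N}, s @: A = A' /\ s @: e = e'.
Proof.
move=> dA dA' cA ce.
pose c (X Y : {set 'I_N}) i := (i \in X, i \in Y).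
pose cls X Y b := [set i | c X Y i == b].
have cnt X Y b : count_mem b [tuple c X Y i | i < N] =
    #|cls X Y b|.
  rewrite -sum1_count big_map big_enum_cond -sum1_card.
  by apply: eq_bigl => i; rewrite !inE.
have : perm_eq [tuple c A e i | i < N] [tuple c A' e' i | i < N].
  apply/allP => b _ /=; rewrite !cnt.
  have d1 (X Y : {set 'I_N}) : [disjoint Y & X] -> #|cls X Y (true, true)| = 0%N.
    move=> d; apply/eqP; rewrite cards_eq0; apply/eqP/setP => i.
    rewrite !inE xpair_eqE !eqb_id.
    by case: (boolP (i \in Y)) => [/(disjointFr d)->|]; rewrite ?andbF.
  have d2 (X Y : {set 'I_N}) : [disjoint Y & X] -> #|cls X Y (true, false)| = #|X|.
    move=> d; apply: eq_card => i; rewrite !inE xpair_eqE eqb_id eqbF_neg.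
    by case: (boolP (i \in X)) => [/(disjointFl d)->|].
  have d3 (X Y : {set 'I_N}) : [disjoint Y & X] -> #|cls X Y (false, true)| = #|Y|.
    move=> d; apply: eq_card => i; rewrite !inE xpair_eqE eqb_id eqbF_neg.
    by case: (boolP (i \in Y)) => [/(disjointFr d)->|]; rewrite ?andbF.
  have d4 (X Y : {set 'I_N}) : [disjoint Y & X] -> #|cls X Y (false, false)| =
      (N - (#|X| + #|Y|))%N.
    move=> d; have -> : (#|X| + #|Y|)%N = #|X :|: Y|.
      by rewrite cardsU (_ : X :&: Y = set0) ?cards0 ?subn0//; apply/eqP;
        rewrite setI_eq0 disjoint_sym.
    rewrite cardsCs card_ord; congr (_ - _)%N; apply: eq_card => i.
    by rewrite !inE xpair_eqE !eqbF_neg negb_and !negbK.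
  by case: b => [[] []]; rewrite ?d1 ?d2 ?d3 ?d4 ?cA ?ce.
case/tuple_permP => s sE.
have sP i : c A e i = c A' e' (s i).
  have := congr1 (fun z => nth (c A e i) z i) sE.
  by rewrite -!tnth_nth !tnth_mktuple.
exists s; split; apply/eqP;
  rewrite eqEcard card_imset ?cA ?ce ?leqnn ?andbT; try exact: perm_inj;
  apply/subsetP => _ /imsetP[i iA ->]; by have [] := sP i; rewrite iA.
Qed.

(** * Revealing the edges that meet a vertex set *)

Section FreeGraphs.
Variables (R : realType) (l : nat) (V : finType) (H : {set {set V}}) (N : nat).
Hypothesis H_edge : (0 < #|H|)%N.
Implicit Types (A B e : {set 'I_N}).

Let F : {set {set {set 'I_N}}} := [set G | free_graph l H G].

Definition meets A : {set {set 'I_N}} :=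
  [set e : {set 'I_N} | (#|e| == l) && ~~ [disjoint e & A]].

(** The conditional entropy of the indicator of [e] given the edges meeting [A]. *)
Definition gain A e : R :=
  ent R F (meets A :|: [set e]) - ent R F (meets A).

Lemma free_graphs_neq0 : F != set0.
Proof. by apply/set0Pn; exists set0; rewrite inE free_set0. Qed.

Lemma free_edge_card G e : G \in F -> e \in G -> #|e| = l.
Proof. by rewrite inE => /andP[/forallP/(_ e) h _] eG; move: h; rewrite eG => /eqP. Qed.

Lemma meetsS A B : A \subset B -> meets A \subset meets B.
Proof.
move=> AB; apply/subsetP => e; rewrite !inE => /andP[-> /=].
by apply: contra; exact: disjointWr.
Qed.

Lemma gain_ge0 A e : 0 <= gain A e.
Proof. by rewrite subr_ge0 ent_mono// subsetUl. Qed.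

Lemma gain_le1 A e : gain A e <= 1.
Proof.
have := ent_subadd R (meets A) [set e] free_graphs_neq0.
have := ent_le R [set e] free_graphs_neq0; rewrite cards1 mul1r.
have := ln2_le1 R; rewrite /gain; lra.
Qed.

Lemma gain_anti A B e : A \subset B -> gain B e <= gain A e.
Proof.
move=> AB; have := ent_submod R (meets A) (meets B) [set e] free_graphs_neq0.
by rewrite (setUidPr (meetsS AB)).
Qed.

Lemma imset_meets (s : {perm 'I_N}) A :
  [set s @: (e : {set 'I_N}) | e in meets A] = meets (s @: A).
Proof.
have si := @perm_inj _ s.
have dE (X Y : {set 'I_N}) : [disjoint s @: X & s @: Y] = [disjoint X & Y].
  rewrite -!setI_eq0 -imsetI; last by move=> ? ? _ _; exact: si.
  by rewrite -!cards_eq0 card_imset.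
apply/setP => e; apply/imsetP/idP => [[f + ->]|].
  by rewrite !inE card_imset// dE.
have eE : e = s @: (s^-1%g @: e).
  by rewrite -imset_comp (eq_imset (g := id)) ?imset_id// => x /=; rewrite permKV.
move=> eA; exists (s^-1%g @: e) => //; move: eA.
by rewrite {1}eE !inE dE card_imset.
Qed.

(** Some permutation of the vertices maps one pair to the other, and it maps [F] to
    itself.  Thus [gain A e] depends on [#|A|] alone once [#|e| = l]. *)
Lemma gain_sym A e A' e' :
  [disjoint e & A] -> [disjoint e' & A'] -> #|A| = #|A'| -> #|e| = #|e'| ->
  gain A e = gain A' e'.
Proof.
move=> dA dA' cA ce; have [s [sA se]] := perm_disjoint_pairs dA dA' cA ce.
pose phi (f : {set 'I_N}) := s @: f.
have pI : injective phi by apply: imset_inj; exact: perm_inj.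
have pF : {in F, forall G : {set {set 'I_N}}, phi @: G \in F}.
  move=> G; rewrite !inE => /(free_pullback (@perm_inj _ s^-1%g)).
  congr free_graph; apply/setP => f; rewrite inE; apply/idP/imsetP => [fG|[g gG ->]].
    exists (s^-1%g @: f) => //.
    by rewrite /phi -imset_comp (eq_imset (g := id)) ?imset_id// => x /=; rewrite permKV.
  by rewrite /phi -imset_comp (eq_imset (g := id)) ?imset_id// => x /=; rewrite permK.
rewrite /gain -(ent_imset R (meets A) pI pF) -(ent_imset R (_ :|: _) pI pF).
by rewrite imsetU imset_set1 /phi se imset_meets sA.
Qed.

Definition initial (k : nat) : {set 'I_N} := [set i : 'I_N | (i < k)%N].

Lemma card_initial k : (k <= N)%N -> #|initial k| = k.
Proof.
move=> kN; have wI : injective (widen_ord kN).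
  by move=> i j /(congr1 val) ij; exact: val_inj.
rewrite -[RHS]card_ord -(card_imset _ wI).
apply: eq_card => i; rewrite inE; apply/idP/imsetP => [ik|[j _ ->]]; last first.
  by rewrite /= ltn_ord.
by exists (Ordinal ik) => //; exact: val_inj.
Qed.

Lemma initialS k k' : (k <= k')%N -> initial k \subset initial k'.
Proof. by move=> kk'; apply/subsetP => i; rewrite !inE => /leq_trans; exact. Qed.

Lemma card_initialD k k' : (k <= k' <= N)%N -> #|initial k' :\: initial k| = (k' - k)%N.
Proof.
move=> /andP[kk' k'N]; rewrite cardsD (setIidPr (initialS kk')).
by rewrite !card_initial// (leq_trans kk').
Qed.

Lemma disjoint_initialD k k' : [disjoint initial k' :\: initial k & initial k].
Proof. by rewrite disjoint_sym disjoints_subset setCD subsetUr. Qed.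

(** The trace is the copy of an [H]-free graph on ['I_M] under the translation by
    [k]. *)
Lemma card_free_trace M k (G : {set {set 'I_N}}) : (k + M <= N)%N -> G \in F ->
  (#|G :&: [set e : {set 'I_N} | e \subset initial (k + M) :\: initial k & #|e| == l]|
     <= turan_number l H M)%N.
Proof.
move=> kMN GF.
have lt (i : 'I_M) : (k + i < N)%N by rewrite (leq_trans _ kMN)// ltn_add2l.
pose g (i : 'I_M) : 'I_N := Ordinal (lt i).
have gI : injective g by move=> i j [] /addnI ij; exact: val_inj.
have free : free_graph l H (pullback g G).
  by apply: free_pullback => //; move: GF; rewrite inE.
apply: (@leq_trans #|pullback g G|); last exact: leq_bigmax_cond.
apply: (leq_trans _ (leq_imset_card (fun e : {set 'I_M} => g @: e) _)).
apply/subset_leq_card/subsetP => e; rewrite !inE => /andP[eG /andP[/subsetP eB _]].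
have eE : e = g @: (g @^-1: e).
  apply/setP => x; apply/idP/imsetP => [xe|[y + ->]]; last by rewrite inE.
  have := eB x xe; rewrite !inE -leqNgt => /andP[kx xkM].
  have xM : (x - k < M)%N by rewrite ltn_subLR.
  by exists (Ordinal xM); [rewrite inE|]; rewrite (_ : g _ = x)//; apply: val_inj; rewrite /= subnKC.
by apply/imsetP; exists (g @^-1: e); rewrite // inE -eE.
Qed.

Lemma gainE A e :
  gain A e = mean F (fun G => ent R (fiber F (meets A) G) [set e]).
Proof. by rewrite /gain entU addrAC subrr add0r. Qed.

(** The last factor bounds the total correlation of the edges inside the [M] vertices
    [B := initial (k + M) :\: initial k], given those meeting [initial k].  Indeed,
    given also any other edges inside [B], the conditional entropy of an edge [f] is
    at least [gain (initial k :|: B :\: f) f], since all of them meet [B :\: f]; and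
    that vertex set has at most [k + M] elements.  It remains to average
    [sum_ent1_le] over the fibers. *)
Lemma gain_bound k M e (s : R) :
  (l <= M)%N -> (k + M <= N)%N -> #|e| = l -> [disjoint e & initial (k + M)] ->
  0 < s -> s <= 2^-1 ->
  'C(M, l)%:R * gain (initial k) e <=
    (turan_number l H M)%:R * ln 2 + 3 * s * 'C(M, l)%:R +
    'C(M, l)%:R / s ^+ (2 * 'C(M, l)) *
      ('C(M, l)%:R * (gain (initial k) e - gain (initial (k + M)) e)).
Proof.
move=> lM kMN el eM s0 s12.
set B := initial (k + M) :\: initial k.
have Bcard : #|B| = M by rewrite card_initialD ?leq_addr// addKn.
pose Q := [set f : {set 'I_N} | f \subset B & #|f| == l].
have Qcard : #|Q| = 'C(M, l) by rewrite cards_draws Bcard.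
have ek : [disjoint e & initial k] by apply: disjointWr eM; rewrite initialS// leq_addr.
pose S := meets (initial k).
have sumQ : \sum_(f in Q) mean F (fun G => ent R (fiber F S G) [set f]) =
            'C(M, l)%:R * gain (initial k) e.
  rewrite -Qcard mulr_natl -sumr_const; apply: eq_bigr => f.
  rewrite inE -gainE => /andP[fB /eqP fl]; apply: gain_sym => //; last by rewrite fl.
  by apply: disjointWl fB _; exact: disjoint_initialD.
have entQ : 'C(M, l)%:R * gain (initial (k + M)) e <=
            mean F (fun G => ent R (fiber F S G) Q).
  have -> : mean F (fun G => ent R (fiber F S G) Q) = ent R F (S :|: Q) - ent R F S.
    by rewrite entU addrAC subrr add0r.
  rewrite -Qcard mulr_natl; apply: ent_chain_ge => f Q' fQ Q'Q.
  move: (fQ); rewrite inE => /andP[fB /eqP fl].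
  pose A := initial k :|: B :\: f.
  have fA : [disjoint f & A].
    rewrite disjoint_sym disjoints_subset subUset; apply/andP; split.
      rewrite -disjoints_subset disjoint_sym; apply: disjointWl fB _.
      exact: disjoint_initialD.
    by rewrite setDE subsetIr.
  have Acard : #|A| = (k + (M - l))%N.
    have lMk : (k <= N)%N by rewrite (leq_trans _ kMN)// leq_addr.
    rewrite cardsU (_ : _ :&: _ = set0) ?cards0 ?subn0; last first.
      apply/eqP; rewrite setI_eq0 disjoint_sym.
      by apply: disjointWl (disjoint_initialD _ _); exact: subsetDl.
    by rewrite card_initial// cardsD (setIidPr fB) Bcard fl.
  have Ak : (k + (M - l) <= k + M)%N by rewrite leq_add2l leq_subr.
  have gA : gain (initial (k + M)) e <= gain A f.
    rewrite (_ : gain A f = gain (initial (k + (M - l))) e); last first.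
      apply: gain_sym; rewrite ?Acard ?card_initial ?el ?fl ?(leq_trans Ak)//.
      by apply: disjointWr eM; exact: initialS.
    by apply: gain_anti; exact: initialS.
  apply: le_trans gA _.
  suff sub : S :|: Q' \subset meets A.
    by have := ent_submod R (S :|: Q') (meets A) [set f] free_graphs_neq0; rewrite (setUidPr sub).
  rewrite subUset meetsS ?subsetUl//=.
  apply/subsetP => f' /(subsetP Q'Q); rewrite !inE => /and3P[f'f f'B f'l].
  rewrite f'l /=; apply: contra f'f => /pred0P f'A.
  rewrite eqEcard fl (eqP f'l) leqnn andbT; apply/subsetP => x xf'.
  have := f'A x; rewrite /= xf' !inE; case: (x \in f) => //=.
  by have := subsetP f'B x xf'; rewrite !inE => ->; rewrite orbT.
pose W G := \sum_(f in Q) ent R (fiber F S G) [set f].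
have WE : mean F W = 'C(M, l)%:R * gain (initial k) e by rewrite mean_sum.
set c := 'C(M, l)%:R / _; set d := _ + 3 * s * _.
have c0 : 0 <= c by rewrite divr_ge0 ?ler0n// exprn_ge0// ltW.
have : mean F W <= mean F (fun G => d + (c * W G + - c * ent R (fiber F S G) Q)).
  apply: le_mean => G GF; rewrite mulNr -mulrBr /d /c -Qcard.
  apply: sum_ent1_le; rewrite ?fiber_neq0// => G' /(subsetP (fiber_sub _ _ _)).
  exact: card_free_trace.
rewrite (meanD F (fun=> d)) mean_cst ?free_graphs_neq0// meanD !meanZ WE => h.
by have := ler_wpM2l c0 entQ; lra.
Qed.

Lemma edges_sub G : G \in F -> G \subset [set e : {set 'I_N} | #|e| == l].
Proof. by move=> GF; apply/subsetP => e /(free_edge_card GF) <-; rewrite inE. Qed.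

Lemma card_meets k : (k <= N)%N ->
  (#|meets (initial k)| + 'C(N - k, l))%N = 'C(N, l).
Proof.
move=> kN; have cC : #|~: initial k| = (N - k)%N by rewrite cardsCs setCK card_ord card_initial.
rewrite -cC -cards_draws -[in RHS](card_ord N) -cardsT -cards_draws.
rewrite -cardsUI (_ : _ :&: _ = set0) ?cards0 ?addn0; last first.
  apply/setP => e; rewrite !inE disjoints_subset.
  by case: (e \subset _); rewrite ?andbF ?andbT.
apply: eq_card => e; rewrite !inE subsetT disjoints_subset /=.
by case: (e \subset _); rewrite ?andbF ?andbT ?orbF.
Qed.

(** Reveal the edges meeting [initial k] at the cost of one bit each, then the
    others, which all have conditional entropy [gain (initial k) e]. *)
Lemma ln_free_le k e : (k <= N)%N -> #|e| = l -> [disjoint e & initial k] ->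
  ln (nb_free l H N)%:R <=
    #|meets (initial k)|%:R * ln 2 + 'C(N, l)%:R * gain (initial k) e.
Proof.
move=> kN el ek.
have -> : nb_free l H N = #|F| by apply: eq_card => G; rewrite !inE.
rewrite -(ent_total R edges_sub free_graphs_neq0).
pose Q := [set f : {set 'I_N} | f \subset ~: initial k & #|f| == l].
have -> : [set f : {set 'I_N} | #|f| == l] = meets (initial k) :|: Q.
  apply/setP => f; rewrite !inE disjoints_subset.
  by case: (f \subset _); rewrite ?andbF ?andbT ?orbF.
rewrite entU lerD ?ent_le ?free_graphs_neq0//.
apply: (@le_trans _ _ (mean F (fun G => \sum_(f in Q)
    ent R (fiber F (meets (initial k)) G) [set f]))).
  by apply: le_mean => G GF; rewrite ent_le_sum ?fiber_neq0.
rewrite mean_sum (eq_bigr (fun=> gain (initial k) e)) => [|f].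
  rewrite sumr_const -[_ *+ #|_|]mulr_natl ler_wpM2r ?gain_ge0// ler_nat.
  rewrite cards_draws cardsCs setCK card_ord card_initial//.
  by rewrite leq_bin2l// leq_subr.
rewrite inE -gainE => /andP[fB /eqP fl]; apply: gain_sym; rewrite ?el//.
by rewrite disjoints_subset.
Qed.

End FreeGraphs.

(** * Asymptotics *)

Lemma exists_small_drop (R : realType) (b : nat -> R) T :
  (0 < T)%N -> b 0 <= 1 -> 0 <= b T ->
  exists2 t, (t < T)%N & b t - b t.+1 <= T%:R^-1.
Proof.
move=> T0 b0 bT.
have [/existsP[t tP]|/existsPn h] :=
  boolP [exists t : 'I_T, b t - b t.+1 <= T%:R^-1]; first by exists t.
have {}h t : (t < T)%N -> b t.+1 < b t - T%:R^-1.
  by move=> tT; have := h (Ordinal tT); rewrite /= -ltNge; lra.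
have bn n : (n <= T)%N -> b n <= 1 - n%:R / T%:R.
  elim: n => [|n IH] nT; first by rewrite mul0r subr0.
  have := IH (ltnW nT); have := h n nT.
  by rewrite -addn1 natrD mulrDl; lra.
case: T T0 bT h bn => // T _ bT h bn; exfalso.
have := h T (leqnn _); have := bn T (leqnSn _).
have : T%:R / T.+1%:R + T.+1%:R^-1 = 1 :> R.
  by rewrite -[X in _ + X]mul1r -mulrDl natr1 divff ?pnatr_eq0.
move: bT; move: (b T.+1) (b T) T.+1%:R^-1 (T%:R / T.+1%:R).
by move=> *; lra.
Qed.

Lemma bin_sub_le N k l : (k <= N)%N ->
  ('C(N, l.+1) <= 'C(N - k, l.+1) + k * 'C(N.-1, l))%N.
Proof.
elim: k => [|k IH] kN; first by rewrite subn0 mul0n addn0.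
apply: (leq_trans (IH (ltnW kN))).
have -> : (N - k = (N - k.+1).+1)%N by lia.
rewrite binS -addnA leq_add2l mulSn leq_add2r; apply: leq_bin2l; lia.
Qed.

Section Asymptotics.
Variables (R : realType) (l : nat) (V : finType) (H : {set {set V}}).
Hypothesis H_edge : (0 < #|H|)%N.

Definition turan_ratio N : R := (turan_number l H N)%:R / 'C(N, l)%:R.

Definition log_ratio N : R := ln (nb_free l H N)%:R / (ln 2 * 'C(N, l)%:R).

(** Each vertex lies in a proportion [l / N] of all the [l]-sets. *)
Lemma meets_le N k : (k <= N)%N ->
  (#|meets l (initial N k)| * N <= k * l * 'C(N, l))%N.
Proof.
move=> kN; have := card_meets l kN; case: l => [|l'].
  by rewrite !bin0 => /eqP; rewrite -{2}[1%N]add0n eqn_add2r => /eqP ->.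
move=> e; have m : (#|meets l'.+1 (initial N k)| <= k * 'C(N.-1, l'))%N.
  by have := bin_sub_le l' kN; rewrite -e addnC leq_add2l.
apply: (leq_trans (leq_mul m (leqnn _))).
case: N kN m {e} => [|N'] kN m; first by rewrite muln0.
by rewrite -!mulnA (mulnC 'C(_, _)) mul_bin_diag.
Qed.

Lemma nb_free_gt0 N : (0 < nb_free l H N)%N.
Proof. by apply/card_gt0P; exists set0; rewrite inE; exact: free_set0. Qed.

Lemma nb_free_small N : (N < l)%N -> nb_free l H N = 1%N.
Proof.
move=> Nl; rewrite -(cards1 (set0 : {set {set 'I_N}})).
apply: eq_card => G; rewrite !inE; apply/idP/eqP => [|->]; last exact: free_set0.
case/andP=> /forallP Gu _; apply/setP => e; rewrite inE; apply/negP => eG.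
have := Gu e; rewrite eG => /eqP el.
by have := max_card (mem e); rewrite card_ord el leqNgt Nl.
Qed.

Lemma turan_ratio_le N : (l <= N)%N -> turan_ratio N <= log_ratio N.
Proof.
move=> lN; have C0 : 0 < 'C(N, l)%:R :> R by rewrite ltr0n bin_gt0.
rewrite /turan_ratio /log_ratio invfM mulrA ler_pM2r ?invr_gt0//.
rewrite ler_pdivlMr ?ln2_gt0// mulr_natl -lnXn// -natrX.
rewrite ler_ln ?posrE ?ltr0n ?expn_gt0 ?nb_free_gt0// ler_nat.
have F0 : (0 < #|[pred G : {set {set 'I_N}} | free_graph l H G]|)%N.
  exact: nb_free_gt0.
have [G GF GE] := eq_bigmax_cond (fun G : {set {set 'I_N}} => #|G|) F0.
have -> : turan_number l H N = #|G| by exact: GE.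
rewrite -card_powerset; apply/subset_leq_card/subsetP => G'.
by rewrite !inE => /free_sub; apply.
Qed.

Lemma ln_free_upper M N T (s : R) :
  (l <= M)%N -> (0 < T)%N -> (0 < N)%N -> (T.+1 * M <= N)%N ->
  0 < s -> s <= 2^-1 ->
  ln (nb_free l H N)%:R <= 'C(N, l)%:R *
    (turan_ratio M * ln 2 + 3 * s + 'C(M, l)%:R / s ^+ (2 * 'C(M, l)) / T%:R
     + (T * M * l)%:R / N%:R).
Proof.
move=> lM T0 N0 TN s0 s12.
have TlN : (T * M + l <= N)%N by rewrite (leq_trans _ TN)// mulSn addnC leq_add2r.
(* A single edge, disjoint from all the vertex sets that may be revealed. *)
pose e := initial N (T * M + l) :\: initial N (T * M).
have el : #|e| = l by rewrite card_initialD ?leq_addr ?TlN// addKn.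
have edis k : (k <= T * M)%N -> [disjoint e & initial N k].
  by move=> kT; apply: disjointWr (disjoint_initialD _ _ _); exact: initialS.
pose b t : R := gain R l H (initial N (t * M)) e.
have b0 : b 0 <= 1 by exact: gain_le1.
have bT : 0 <= b T by exact: gain_ge0.
have [t tT bt] := exists_small_drop T0 b0 bT.
have tMT : (t * M + M <= T * M)%N by rewrite addnC -mulSn leq_mul2r tT orbT.
have TMN : (T * M <= N)%N by rewrite (leq_trans _ TlN)// leq_addr.
have tMN : (t * M <= N)%N by rewrite (leq_trans _ TMN)// leq_mul2r (ltnW tT) orbT.
have K0 : 0 < 'C(M, l)%:R :> R by rewrite ltr0n bin_gt0.
have sK : 0 < s ^+ (2 * 'C(M, l)) by rewrite exprn_gt0.
have btb : b t <= turan_ratio M * ln 2 + 3 * s +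
    'C(M, l)%:R / s ^+ (2 * 'C(M, l)) / T%:R.
  have := gain_bound H_edge lM (leq_trans tMT TMN) el (edis _ tMT) s0 s12.
  rewrite -/(b t) (_ : gain _ _ _ (initial N (t * M + M)) e = b t.+1); last first.
    by rewrite /b mulSn addnC.
  move=> gb; rewrite -(ler_pM2l K0); apply: le_trans gb _.
  have -> : 'C(M, l)%:R * (turan_ratio M * ln 2 + 3 * s +
      'C(M, l)%:R / s ^+ (2 * 'C(M, l)) / T%:R) =
     (turan_number l H M)%:R * ln 2 + 3 * s * 'C(M, l)%:R +
     'C(M, l)%:R / s ^+ (2 * 'C(M, l)) * ('C(M, l)%:R * T%:R^-1).
    rewrite /turan_ratio; field; rewrite pnatr_eq0 -lt0n T0.
    by rewrite !gt_eqF.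
  by rewrite lerD2l ler_pM2l ?divr_gt0// ler_pM2l.
have := ln_free_le R H_edge tMN el (edis _ (leq_trans (leq_addr _ _) tMT)).
move=> /le_trans; apply; rewrite -/(b t) [leRHS]mulrDr addrC lerD//.
  by rewrite ler_wpM2l ?ler0n.
apply: (@le_trans _ _ #|meets l (initial N (t * M))|%:R).
  by rewrite ler_piMr ?ler0n ?ln2_le1.
rewrite mulrA ler_pdivlMr ?ltr0n// -!natrM ler_nat.
apply: leq_trans (meets_le tMN) _; rewrite mulnC leq_mul2l !leq_mul2r (ltnW tT).
by rewrite !orbT.
Qed.

(** In [ln_free_upper] choose [s], then [T], then [N]. *)
Lemma log_ratio_upper M (eps : R) : (l <= M)%N -> 0 < eps ->
  exists N0, forall N, (N0 <= N)%N -> log_ratio N <= turan_ratio M + eps.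
Proof.
move=> lM e0.
(* Dividing by [ln 2 >= 1 / 2] at most doubles the three error terms, so each is made
   at most [eps / 6]. *)
pose s : R := Num.min 2^-1 (eps / 18).
have s0 : 0 < s by rewrite lt_min invr_gt0 ltr0n divr_gt0 ?ltr0n.
have s12 : s <= 2^-1 by rewrite ge_min lexx.
have s18 : s <= eps / 18 by rewrite ge_min lexx orbT.
pose x := 'C(M, l)%:R / s ^+ (2 * 'C(M, l)).
have x0 : 0 <= x by rewrite divr_ge0 ?ler0n// exprn_ge0// ltW.
pose T := (Num.bound (x * 6 / eps)).+1.
have xT : x / T%:R <= eps / 6.
  rewrite ler_pdivrMr ?ltr0n// mulrAC ler_pdivlMr ?ltr0n//.
  rewrite -ler_pdivrMl// mulrC; apply/ltW.
  have : x * 6 / eps < (Num.bound (x * 6 / eps))%:R.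
    by apply: archi_boundP; apply: divr_ge0 (ltW e0); apply: mulr_ge0.
  by move/lt_le_trans; apply; rewrite ler_nat.
pose y : R := (T * M * l)%:R.
exists (T.+1 * M + l + (Num.bound (y * 6 / eps)).+1)%N => N N0N.
have lN : (l <= N)%N by lia.
have N0 : (0 < N)%N by lia.
have TN : (T.+1 * M <= N)%N by lia.
have yN : y / N%:R <= eps / 6.
  rewrite ler_pdivrMr ?ltr0n// mulrAC ler_pdivlMr ?ltr0n//.
  rewrite -ler_pdivrMl// mulrC; apply/ltW.
  have : y * 6 / eps < (Num.bound (y * 6 / eps))%:R.
    by apply: archi_boundP; apply: divr_ge0 (ltW e0); apply: mulr_ge0.
  by move/lt_le_trans; apply; rewrite ler_nat; lia.
have C0 : 0 < 'C(N, l)%:R :> R by rewrite ltr0n bin_gt0.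
rewrite ler_pdivrMr ?mulr_gt0 ?ln2_gt0//.
have := ln_free_upper lM (ltn0Sn _ : 0 < T)%N N0 TN s0 s12.
rewrite -/x -/y => /le_trans; apply.
rewrite [leRHS]mulrA [leLHS]mulrC ler_pM2r//.
have : eps * 2^-1 <= eps * ln 2 by rewrite ler_pM2l ?ln2_ge_half.
by lra.
Qed.

End Asymptotics.

(** Both limits are the infimum of [u m] over [m >= l]. *)
Lemma common_limit (R : realType) (u v : nat -> R) (l : nat) :
  (forall n, 0 <= u n) -> (forall n, (l <= n)%N -> u n <= v n) ->
  (forall m (eps : R), (l <= m)%N -> 0 < eps ->
     exists n0, forall n, (n0 <= n)%N -> v n <= u m + eps) ->
  exists2 L : R, u n @[n --> \oo] --> L & v n @[n --> \oo] --> L.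
Proof.
move=> u0 uv vu; pose U (x : R) := exists2 m, (l <= m)%N & x = u m.
have Uinf : classical_sets.has_inf U.
  split; first by exists (u l), l.
  by exists 0 => _ [m _ ->].
have Ll n : (l <= n)%N -> inf U <= u n by move=> ln; apply: ge_inf; [case: Uinf|exists n].
have near (eps : R) : 0 < eps -> exists n0, forall n, (n0 <= n)%N ->
    [/\ inf U <= u n, u n <= v n & v n <= inf U + eps].
  move=> e0; have e2 : 0 < eps / 2 by rewrite divr_gt0 ?ltr0n.
  have [_ [m lm ->] mL] := inf_adherent e2 Uinf.
  have [n0 hn] := vu m _ lm e2.
  exists (maxn l n0) => n; rewrite geq_max => /andP[ln n0n].
  split; [exact: Ll|exact: uv|]; have := hn n n0n; lra.
exists (inf U); apply/cvgrPdist_le => eps /near[n0 hn]; exists n0 => // n /= /hn[? ? ?].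
  by rewrite distrC ler_norml; apply/andP; split; lra.
by rewrite distrC ler_norml; apply/andP; split; lra.
Qed.

Theorem corollary2p4 (R : realType) (l : nat) (V : finType)
    (H : {set {set V}}) (H_uniform : uniform l H) (H_edge : (0 < #|H|)%N) :
  exists2 o1 : nat -> R, o1 n @[n --> \oo] --> 0 &
    forall N : nat,
      (nb_free l H N)%:R =
        2 `^ ((turan_density R l H + o1 N) * 'C(N, l)%:R).
Proof.
have u0 n : 0 <= turan_ratio R l H n by rewrite divr_ge0 ?ler0n.
have [L uL vL] := common_limit u0 (turan_ratio_le R H_edge)
  (fun m eps => @log_ratio_upper R l V H H_edge m eps).
have -> : turan_density R l H = L by exact: cvg_lim uL.
exists (fun N => log_ratio R l H N - L).
  by rewrite -(subrr L); apply: cvgB => //; exact: cvg_cst.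
move=> N; rewrite addrC subrK.
(* For [N < l] the binomial coefficient vanishes and the empty graph is the only
   one. *)
have [lN|Nl] := leqP l N; last by rewrite bin_small// mulr0 powRr0 nb_free_small.
apply: ln_inj; rewrite ?posrE ?powR_gt0 ?ltr0n ?nb_free_gt0//.
have C0 : 'C(N, l)%:R != 0 :> R by rewrite pnatr_eq0 -lt0n bin_gt0.
rewrite ln_powR /log_ratio; field.
by rewrite C0 gt_eqF// ln2_gt0.
Qed.
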